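(* Let $p\ge 1$ be an integer and let $f:\mathbb{R}^n\to\mathbb{R}$ be a convex, $p$ times differentiable function whose $p$-th derivative is Lipschitz continuous with constant $M_p$, i.e. $\|\nabla^p f(x)-\nabla^p f(y)\|_2\le M_p\|x-y\|_2$ for all $x,y\in\mathbb{R}^n$. Let $x_*$ be a solution of the problem of minimizing $f$ over $\mathbb{R}^n$, and let $f^*=f(x_* )$. Let the sequence $(x^k,y^k,u^k)$, $k\ge 0$, be generated by the Optimal Tensor Method (described in the context) from starting points $u^0,y^0\in\mathbb{R}^n$. Then, for every iteration number $N\ge1$, $$f(y^N)-f^*\le \frac{c\,M_p\,\|y^0-x_*\|_2^{p+1}}{N^{\frac{3p+1}{2}}},\qquad c=\frac{2^{\frac{3(p+1)^2+4}{4}}(p+1)}{p!}.$$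
   Context: $\|\cdot\|_2$ is the Euclidean norm on $\mathbb{R}^n$. $\nabla^r f(x)[h_1,\dots,h_r]$ denotes the $r$-th directional derivative of $f$ at $x$ along $h_1,\dots,h_r\in\mathbb{R}^n$ (for $r=0$ it is $f(x)$), and the norm of the symmetric $p$-linear form is $\|\nabla^p f(x)\|_2=\max\{\nabla^p f(x)[h_1,\dots,h_p]:\|h_i\|_2\le 1,\ i=1,\dots,p\}$ (likewise for the difference $\nabla^p f(x)-\nabla^p f(y)$). For a function $g$, an integer $p\ge1$, and $M\ge 0$, $T^{g}_{p,M}(x)$ denotes a point of $$\operatorname{Arg}\min_{y\in\mathbb{R}^n}\left\{\sum_{r=0}^p\frac{1}{r!}\nabla^r g(x)[\underbrace{y-x,\dots,y-x}_{r}]+\frac{M}{(p+1)!}\|y-x\|_2^{p+1}\right\}.$$ For $L\ge0$ and $z\in\mathbb{R}^n$, put $F_{L,z}(x)=f(x)+\frac{L}{2}\|x-z\|_2^2$. Optimal Tensor Method. Input: starting points $u^0,y^0$, iteration number $N$; $A_0=0$. For $k=0,1,2,\dots,N-1$: choose $L_k>0$ such that $$\frac12\le\frac{2(p+1)M_p}{p!\,L_k}\|y^{k+1}-x^k\|_2^{p-1}\le 1,$$ where $$a_{k+1}=\frac{1/L_k+\sqrt{1/L_k^2+4A_k/L_k}}{2},\qquad A_{k+1}=A_k+a_{k+1},$$ $$x^k=\frac{A_k}{A_{k+1}}y^k+\frac{a_{k+1}}{A_{k+1}}u^k,\qquad y^{k+1}=T^{F_{L_k,x^k}}_{p,pM_p}(x^k);$$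 then set $u^{k+1}=u^k-a_{k+1}\nabla f(y^{k+1})$. Output: $y^N$.
   Formalization: The formal statement assumes a common starting point u^0 = y^0; for independent starting points the claim fails, e.g. n = p = 1, f(t) = t^2/2, M_1 = 2, y^0 = x_* = 0, u^0 = 1, L_0 = 8 gives f(y^1) - f^* = 1/8 while the bound is 0. *)

(* Defs.v *)
From mathcomp Require Export all_boot all_order all_algebra.
From mathcomp Require Export all_classical all_reals all_analysis.
Export Order.TTheory GRing.Theory Num.Theory.
Export numFieldNormedType.Exports.

Set Implicit Arguments.
Unset Strict Implicit.
Unset Printing Implicit Defensive.

Local Open Scope classical_set_scope.
Local Open Scope ring_scope.

(* The canonical norm `|v| on 'rV[R]_n is the max-norm, whence this
   definition; both norms induce the topology used by [differentiable]. *)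
Definition norm2 (R : realType) (n : nat) (v : 'rV[R]_n) : R :=
  Num.sqrt (\sum_(i < n) v 0 i ^+ 2).

Definition minimizer (R : realType) (T : Type) (phi : T -> R) (y : T) : Prop :=
  forall z, phi y <= phi z.

(* nabla^r f(x)[h_1, ..., h_r] for hs = [:: h_1; ...; h_r]. *)
Definition dirder (R : realType) (n : nat) (f : 'rV[R]_n -> R)
    (hs : seq 'rV[R]_n) : 'rV[R]_n -> R :=
  foldr (fun h g x => 'D_h g x) f hs.

(* p times (Frechet) differentiable everywhere. The differential, a map into
   the finite-dimensional dual of R^n, is p - 1 times differentiable exactly
   when each of its evaluations x |-> 'D_h f x is. *)
Fixpoint times_differentiable (R : realType) (n : nat) (p : nat)
    (f : 'rV[R]_n -> R) : Prop :=
  if p is q.+1 then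
    (forall x, differentiable f x) /\
    (forall h, times_differentiable q (fun x => 'D_h f x))
  else True.

(* The norm of a p-linear form, as a supremum in the extended reals (so that
   no junk value can occur); it is the maximum whenever T is p-linear. *)
Definition form_norm2 (R : realType) (n p : nat)
    (T : p.-tuple 'rV[R]_n -> R) : \bar R :=
  ereal_sup [set (T h)%:E |
    h in [set h : p.-tuple 'rV[R]_n | forall i, norm2 (tnth h i) <= 1]].

Definition lipschitz_dirder (R : realType) (n p : nat) (M : R)
    (f : 'rV[R]_n -> R) : Prop :=
  forall x y,
    (form_norm2 (fun h : p.-tuple 'rV[R]_n => (dirder f h x - dirder f h y)%R)
     <= (M * norm2 (x - y))%:E)%E.

Definition grad (R : realType) (n : nat) (f : 'rV[R]_n -> R) (x : 'rV[R]_n) :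
    'rV[R]_n :=
  \row_i 'D_(delta_mx 0 i) f x.

Definition tensor_model (R : realType) (n p : nat) (M : R)
    (g : 'rV[R]_n -> R) (x y : 'rV[R]_n) : R :=
  \sum_(r < p.+1) (r`!%:R)^-1 * dirder g (nseq r (y - x)) x
  + M / (p.+1)`!%:R * norm2 (y - x) ^+ p.+1.

(* y is a possible value of T^g_{p,M}(x). *)
Definition is_tensor_step (R : realType) (n p : nat) (M : R)
    (g : 'rV[R]_n -> R) (x y : 'rV[R]_n) : Prop :=
  minimizer (tensor_model p M g x) y.

Definition regularized (R : realType) (n : nat) (f : 'rV[R]_n -> R) (L : R)
    (z x : 'rV[R]_n) : R :=
  f x + L / 2 * norm2 (x - z) ^+ 2.

(* The sequences are produced by N iterations from the starting points u 0 and
   y 0; their terms beyond those N iterations, and a 0, are unconstrained. For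
   p = 1 the factor norm2 _ ^+ p.-1 is 1, also when y k.+1 = x k. *)
Record optimal_tensor_method (R : realType) (n p : nat) (M : R)
    (f : 'rV[R]_n -> R) (N : nat) (L a A : nat -> R)
    (x y u : nat -> 'rV[R]_n) : Prop := OptimalTensorMethod {
  otm_A0 : A 0%N = 0;
  otm_L_gt0 : forall k, (k < N)%N -> 0 < L k;
  otm_a : forall k, (k < N)%N ->
    a k.+1 = ((L k)^-1 + Num.sqrt ((L k ^+ 2)^-1 + 4 * A k / L k)) / 2;
  otm_A : forall k, (k < N)%N -> A k.+1 = A k + a k.+1;
  otm_x : forall k, (k < N)%N ->
    x k = (A k / A k.+1) *: y k + (a k.+1 / A k.+1) *: u k;
  otm_y : forall k, (k < N)%N ->
    is_tensor_step p (p%:R * M) (regularized f (L k) (x k)) (x k) (y k.+1);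
  otm_L : forall k, (k < N)%N ->
    1 / 2 <= 2 * (p%:R + 1) * M / (p`!%:R * L k)
             * norm2 (y k.+1 - x k) ^+ p.-1 <= 1;
  otm_u : forall k, (k < N)%N -> u k.+1 = u k - a k.+1 *: grad f (y k.+1)
}.

(* Main.v *)
Require Import Defs.
From mathcomp Require Import ring lra zify.

(** The tensor step solves, approximately, the proximal equation
    [grad f y' + L (y' - x) = 0]. Indeed stationarity of the model
    ([tensor_step_stationary]) equates the gradient of the Taylor polynomial of
    [f] at [x] with the gradients of the penalties, and Taylor's formula
    ([derive_taylor_le]) compares that gradient with [grad f y']. Differentiating
    the Taylor polynomial uses the multilinearity and the symmetry of higher
    derivatives ([dirder_linear], [dirder_move]). For [p > 1] the residual is at
    most [(p + 1) M / p! * |y' - x|^p], which the choice of [L] bounds by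
    [L / 2 * |y' - x|] ([tensor_step_residual]). For [p = 1] the model ignores the
    proximal term, since its gradient vanishes at its centre, and only
    [L * |y' - x|] is obtained ([gradient_step_residual]).

    An accelerated proximal method tolerates such residuals: the potential
    [A_k (f y_k - f xs) + |u_k - xs|^2 / 2] does not increase, and for [p > 1] it
    even pays for a multiple of [A_(k+1) L_k |y_(k+1) - x_k|^2]
    ([accelerated_step], [otm_potential]). Hence [f y_N - f xs <= D^2 / (2 A_N)]
    with [D = |y_0 - xs|], and the sum of [A_(k+1) L_k |y_(k+1) - x_k|^2] is at
    most [4/3 D^2].

    It remains to bound [A_N] from below. The equation [L a^2 = A + a] yields
    [sqrt A_(k+1) >= sqrt A_k + 1 / (2 sqrt L_k)]. For [p = 1] the [L_k] are
    bounded by [8 M] and [A_N] grows like [N^2] ([weights_growth_bounded]). For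
    [p > 1] a large [L_k] forces a long step, because
    [L_k <= C |y_(k+1) - x_k|^(p-1)] with [C = 4 (p + 1) M / p!], and long steps are
    limited by the sum above. Hoelder's inequality combines the two effects into
    the bound [sum_(k<=m) A_k^al <= K A_m^((1-al)/2)] with
    [al = (p-1)/(3p+1)], a discrete differential inequality for the sums on its
    left, which [powR_increments] integrates; the outcome is
    [(2 N / (p + 1))^((3p+1)/2) <= 2^(p+1) (4/3 D^2)^((p-1)/2) C A_N]
    ([weights_growth]). The stated constant absorbs the numerical factors
    ([rate_constant]). *)

Set Implicit Arguments.
Unset Strict Implicit.
Unset Printing Implicit Defensive.

Local Open Scope classical_set_scope.
Local Open Scope ring_scope.

(** * Symmetry of second directional derivatives *)
Section DirectionalDerivatives.
Variables (R : realType) (V : normedModType R).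
Implicit Types (f : V -> R) (x u v : V).

Lemma derive_linear f x a u v : differentiable f x ->
  'D_(a *: u + v) f x = a * 'D_u f x + 'D_v f x.
Proof. by move=> df; rewrite !deriveE// linearP. Qed.

Lemma is_derive_along_line f x v (t : R) : differentiable f (x + t *: v) ->
  is_derive t (1 : R) (fun s : R => f (x + s *: v)) ('D_v f (x + t *: v)).
Proof.
move=> df.
have dl : is_diff t (fun s : R => x + s *: v) (fun s : R => s *: v).
  by apply: is_diff_eq; rewrite add0r.
have := differentiableP df => df'.
have dc : is_diff t (f \o (fun s : R => x + s *: v))
    ('d f (x + t *: v) \o (fun s : R => s *: v)) by exact: is_diff_comp.
split; first by apply: diff_derivable; exact: ex_diff.
by rewrite deriveE ?(@diff_val _ _ _ _ _ _ _ dc) /= ?scale1r ?deriveE.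
Qed.

(** The mean value theorem in the direction [u] turns the second difference
    into [t] times an increment of ['D_u f], which the differential of ['D_u f]
    at [x] controls. *)
Lemma second_difference f x u v e :
  (forall z, differentiable f z) -> differentiable (fun z => 'D_u f z) x ->
  0 < e ->
  \forall t \near 0^'+,
    `|f (x + t *: u + t *: v) - f (x + t *: u) - f (x + t *: v) + f x
      - t ^+ 2 * 'D_v (fun z => 'D_u f z) x|
    <= e * t ^+ 2 * (`|u| *+ 2 + `|v|).
Proof.
move=> df dG e0; set G := fun z => 'D_u f z in dG *.
have /eqaddoP/(_ _ e0) : (fun h => G (x + h)) = (fun h => G x + 'd G x h)
    +o_ (0 : V) id by apply/funext => h; exact: (diff_locallyxC dG).
move=> /nbhs_normP[d /= d0 small].
set C := `|u| *+ 2 + `|v|.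
have C0 : 0 <= C by rewrite addr_ge0// mulrn_wge0.
near=> t.
have t0 : 0 < t by [].
have tC : t * C < d.
  have : t < d / (C + 1) by near: t; apply: nbhs_right_lt; rewrite divr_gt0// ltr_wpDl.
  rewrite ltr_pdivlMr; last by rewrite ltr_wpDl.
  by apply: le_lt_trans; rewrite ler_pM2l// lerDl.
have dg (s : R) : is_derive s 1
    (fun s : R => f (x + t *: v + s *: u) - f (x + s *: u))
    (G (x + t *: v + s *: u) - G (x + s *: u)).
  by apply: is_deriveB; exact: is_derive_along_line.
have [|c /[!in_itv]/= /andP[c0 ct]] :=
    @MVT R _ _ 0 t t0 (fun s _ => dg s).
  by apply: derivable_within_continuous => s _; exact: ex_derive.
rewrite !scale0r !addr0 subr0 => mvt.
have est w : `|w| <= t * C -> `|G (x + w) - (G x + 'd G x w)| <= e * `|w|.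
  by move=> wC; apply: small; rewrite /= sub0r normrN (le_lt_trans wC).
have n1 : `|t *: v + c *: u| <= t * (`|v| + `|u|).
  rewrite (le_trans (ler_normD _ _))// !normrZ !gtr0_norm// mulrDr lerD2l.
  by rewrite ler_wpM2r// ltW.
have n2 : `|c *: u| <= t * `|u| by rewrite normrZ gtr0_norm// ler_wpM2r// ltW.
have u0 := normr_ge0 u; have v0 := normr_ge0 v.
have e1 : `|G (x + (t *: v + c *: u)) - (G x + 'd G x (t *: v + c *: u))| <=
    e * (t * (`|v| + `|u|)).
  apply: (le_trans (est _ _)); last by rewrite ler_wpM2l// ltW.
  by apply: (le_trans n1); rewrite ler_wpM2l ?(ltW t0)// /C mulr2n; lra.
have e2 : `|G (x + c *: u) - (G x + 'd G x (c *: u))| <= e * (t * `|u|).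
  apply: (le_trans (est _ _)); last by rewrite ler_wpM2l// ltW.
  by apply: (le_trans n2); rewrite ler_wpM2l ?(ltW t0)// /C mulr2n; lra.
rewrite deriveE//.
have -> : f (x + t *: u + t *: v) - f (x + t *: u) - f (x + t *: v) + f x
      - t ^+ 2 * 'd G x v =
    t * ((G (x + (t *: v + c *: u)) - (G x + 'd G x (t *: v + c *: u))) -
    (G (x + c *: u) - (G x + 'd G x (c *: u)))).
  have -> : 'd G x (t *: v + c *: u) = t * 'd G x v + 'd G x (c *: u).
    by rewrite linearP.
  rewrite (addrAC x (t *: v) (t *: u)) in mvt; rewrite (addrA x (t *: v)).
  transitivity ((f (x + t *: u + t *: v) - f (x + t *: u)
    - (f (x + t *: v) - f x)) - t ^+ 2 * 'd G x v); first by ring.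
  by rewrite mvt; ring.
rewrite normrM gtr0_norm//.
apply: (@le_trans _ _ (t * (e * (t * (`|v| + `|u|)) + e * (t * `|u|)))).
  by rewrite ler_pM2l// (le_trans (ler_normB _ _))// lerD.
by rewrite /C le_eqVlt; apply/orP; left; apply/eqP; ring.
Unshelve. all: by end_near. Qed.

(** One and the same second difference approximates both mixed derivatives. *)
Lemma derive_comm f x u v : (forall z, differentiable f z) ->
  differentiable (fun z => 'D_u f z) x -> differentiable (fun z => 'D_v f z) x ->
  'D_v (fun z => 'D_u f z) x = 'D_u (fun z => 'D_v f z) x.
Proof.
move=> df du dv; apply/eqP; rewrite -subr_eq0 -normr_le0.
set d := `|_ - _|; set C := (`|u| + `|v|) *+ 3.
have C0 : 0 <= C by rewrite mulrn_wge0// addr_ge0.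
apply/ler_addgt0Pr => e e0; rewrite add0r.
have e'0 : 0 < e / (C + 1) by rewrite divr_gt0// ltr_wpDl.
near (0 : R)^'+ => t.
have t0 : 0 < t by [].
have h1 : `|f (x + t *: u + t *: v) - f (x + t *: u) - f (x + t *: v) + f x
      - t ^+ 2 * 'D_v (fun z => 'D_u f z) x|
    <= e / (C + 1) * t ^+ 2 * (`|u| *+ 2 + `|v|).
  by near: t; exact: second_difference.
have h2 : `|f (x + t *: v + t *: u) - f (x + t *: v) - f (x + t *: u) + f x
      - t ^+ 2 * 'D_u (fun z => 'D_v f z) x|
    <= e / (C + 1) * t ^+ 2 * (`|v| *+ 2 + `|u|).
  by near: t; exact: second_difference.
rewrite (addrAC x (t *: v)) in h2.
have : t ^+ 2 * d <= t ^+ 2 * (e / (C + 1) * C).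
  rewrite -[t ^+ 2 in leLHS]gtr0_norm ?exprn_gt0// -normrM.
  rewrite distrC in h1; move: h1 h2.
  move: ('D_v _ x) ('D_u _ x) (f _) (f _) (f _) (f _) (t ^+ 2) (_ / _).
  move=> D1 D2 f1 f2 f3 f4 t2 k h1 h2.
  have := lerD h1 h2 => /(le_trans (ler_normD _ _)).
  by congr (`|_| <= _); rewrite /C; ring.
rewrite ler_pM2l ?exprn_gt0// => /le_trans; apply.
by rewrite -mulrAC ler_pdivrMr ?ltr_wpDl// ler_pM2l// lerDl.
Unshelve. all: by end_near. Qed.

End DirectionalDerivatives.

(** * Iterated directional derivatives *)
Section IteratedDerivatives.
Variables (R : realType) (n : nat).
Implicit Types (f g : 'rV[R]_n -> R) (x d h u v : 'rV[R]_n).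
Implicit Types (s : seq 'rV[R]_n).

Lemma dirder_cat f s1 s2 : dirder f (s1 ++ s2) = dirder (dirder f s2) s1.
Proof. exact: foldr_cat. Qed.

Lemma times_differentiable_leq p q f : (q <= p)%N ->
  times_differentiable p f -> times_differentiable q f.
Proof.
elim: p q f => [|p IH] [|q] f //= qp [df dDf].
by split=> // h; exact: IH.
Qed.

Lemma times_differentiable_dirder p f s : times_differentiable (size s + p) f ->
  times_differentiable p (dirder f s).
Proof.
elim/last_ind: s f => [|s h IH] f //.
by rewrite size_rcons /dirder foldr_rcons => -[_ /(_ h)]; exact: IH.
Qed.

Lemma differentiable_dirder p f s x : times_differentiable p f ->
  (size s < p)%N -> differentiable (dirder f s) x.
Proof.
move=> fp sp; have : times_differentiable 1 (dirder f s).
  apply: times_differentiable_dirder; apply: times_differentiable_leq fp.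
  by rewrite addn1.
by case.
Qed.

Lemma times_differentiableD p f g : times_differentiable p f ->
  times_differentiable p g -> times_differentiable p (fun z => f z + g z).
Proof.
elim: p f g => [//|p IH] f g [df Df] [dg Dg]; split=> [z|h].
  exact: differentiableD.
have -> : (fun z => 'D_h (fun z => f z + g z) z) = (fun z => 'D_h f z + 'D_h g z).
  by apply/funext => z; rewrite deriveD//; exact: diff_derivable.
exact: IH (Df h) (Dg h).
Qed.

Lemma dirderD p f g s x : times_differentiable p f -> times_differentiable p g ->
  (size s <= p)%N ->
  dirder (fun z => f z + g z) s x = dirder f s x + dirder g s x.
Proof.
move=> fp gp; elim: s x => [//|h s IH] x sp /=.
have -> : dirder (fun z => f z + g z) s = dirder f s + dirder g s.
  by apply/funext => z; rewrite IH// ltnW.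
by rewrite deriveD//; apply: diff_derivable; exact: differentiable_dirder sp.
Qed.

(** The differential is linear in the outermost direction, and ['D_h] preserves
    the linear combination that an inner direction produces. *)
Lemma dirder_linear p f s1 s2 a u v x : times_differentiable p f ->
  (size s1 + size s2 < p)%N ->
  dirder f (s1 ++ (a *: u + v) :: s2) x =
  a * dirder f (s1 ++ u :: s2) x + dirder f (s1 ++ v :: s2) x.
Proof.
move=> fp; elim: s1 x => [|h s1 IH] x sp /=.
  by apply: derive_linear; exact: differentiable_dirder sp.
have -> : dirder f (s1 ++ (a *: u + v) :: s2) =
    a \*: dirder f (s1 ++ u :: s2) + dirder f (s1 ++ v :: s2).
  by apply/funext => z; rewrite IH// ltnW.
have dd w : derivable (dirder f (s1 ++ w :: s2)) x h.
  apply: diff_derivable; apply: (differentiable_dirder _ fp).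
  by rewrite size_cat /= addnS.
by rewrite deriveD ?deriveZ//; exact: derivableZ.
Qed.

Lemma dirderZ p f s1 s2 a u x : times_differentiable p f ->
  (size s1 + size s2 < p)%N ->
  dirder f (s1 ++ (a *: u) :: s2) x = a * dirder f (s1 ++ u :: s2) x.
Proof.
move=> fp sp.
have z0 : dirder f (s1 ++ 0 :: s2) x = 0.
  have := dirder_linear 1 0 0 x fp sp.
  by rewrite scaler0 addr0; lra.
by rewrite -[a *: u]addr0 (dirder_linear _ _ _ _ fp)// z0 addr0.
Qed.

Lemma dirder_nseqZ p f s1 s2 k a u x : times_differentiable p f ->
  (size s1 + k + size s2 <= p)%N ->
  dirder f (s1 ++ nseq k (a *: u) ++ s2) x =
  a ^+ k * dirder f (s1 ++ nseq k u ++ s2) x.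
Proof.
move=> fp; elim: k s1 => [|k IH] s1 sp; first by rewrite expr0 mul1r.
rewrite /= (dirderZ _ _ _ fp); last by rewrite size_cat size_nseq addnA -addSn -addnS.
rewrite -!cat_rcons IH ?exprS ?mulrA// size_rcons.
by rewrite addSnnS.
Qed.

(** Repeated exchange of neighbouring directions by [derive_comm]. Moving a single
    direction is all that the derivative of a homogeneous form requires. *)
Lemma dirder_move p f s s1 s2 h x : times_differentiable p f ->
  (size s + size s1 + size s2 < p)%N ->
  dirder f (s ++ h :: s1 ++ s2) x = dirder f (s ++ s1 ++ h :: s2) x.
Proof.
move=> fp sp; rewrite !(dirder_cat _ s); congr (dirder _ s x).
have {}sp : (size s1 + size s2 < p)%N.
  by apply: leq_ltn_trans sp; rewrite -addnA leq_addl.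
elim: s1 sp => [//|k s1 IH] sp.
rewrite [RHS]/= -IH; last by apply: ltnW.
apply/funext => z /=.
have dd r : (size r < (size (s1 ++ s2)).+2)%N ->
    forall y, differentiable (dirder f r) y.
  move=> rs y; apply: (differentiable_dirder y fp).
  by apply: (leq_trans rs); rewrite size_cat.
rewrite derive_comm//; first exact: dd.
- exact: (dd (k :: s1 ++ s2)).
- exact: (dd (h :: s1 ++ s2)).
Qed.

(** The product rule gives one term for each of the [r] slots that [h] can enter,
    and symmetry makes these terms equal. The prefix [s] collects the directions
    that the induction has already split off. *)
Lemma is_derive_dirder_nseq p f s r d h x : times_differentiable p f ->
  (size s + r <= p)%N ->
  is_derive (0 : R) (1 : R) (fun t : R => dirder f (s ++ nseq r (d + t *: h)) x)
    (r%:R * dirder f (s ++ nseq r.-1 d ++ [:: h]) x).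
Proof.
move=> fp; elim: r s => [|r IH] s sp.
  by rewrite mul0r; exact: (is_derive_cst (dirder f (s ++ [::]) x)).
have -> : (fun t : R => dirder f (s ++ nseq r.+1 (d + t *: h)) x) =
    (fun t : R => dirder f (rcons s d ++ nseq r (d + t *: h)) x) +
    id * (fun t : R => dirder f (rcons s h ++ nseq r (d + t *: h)) x).
  apply/funext => t /=; rewrite addrC (dirder_linear _ _ _ _ fp).
    by rewrite -!cat_rcons (addrC (t *: h)) [LHS]addrC.
  by rewrite size_nseq -addnS.
have spd w : (size (rcons s w) + r <= p)%N by rewrite size_rcons addSnnS.
have H1 := IH _ (spd d); have H2 := IH _ (spd h).
apply: (is_derive_eq (is_deriveD H1 (is_deriveM (is_derive_id _ _) H2))).
rewrite [_%:A]mulr1 [_ *: _]mul0r add0r [0 *: h]scale0r addr0.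
rewrite !cat_rcons.
have -> : dirder f (s ++ h :: nseq r d) x = dirder f (s ++ nseq r d ++ [:: h]) x.
  rewrite -[nseq r d]cats0 (dirder_move _ _ fp) ?cats0//.
  by rewrite size_nseq addn0 -addnS.
case: r {IH H1 H2} sp spd => [|r] sp spd.
  by rewrite mul0r add0r mul1r.
by rewrite /= -[in RHS]natr1 mulrDl mul1r.
Qed.

End IteratedDerivatives.

(** * Calculus on the real line *)
Section RealLine.
Variable R : realType.
Implicit Types (phi : R -> R) (t : R).

Lemma derive_ge0_right phi (D : R) : is_derive (0 : R) (1 : R) phi D ->
  (\forall t \near 0^'+, phi 0 <= phi t) -> 0 <= D.
Proof.
move=> [dphi <-] up.
have c0 : (fun h : R => h^-1 *: ((phi \o shift 0) (h *: (1 : R)) - phi 0)) @ 0^'+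
    --> 'D_1 phi 0.
  by apply: cvg_dnbhs_at_right; exact: dphi.
rewrite -(cvg_lim _ c0)//; apply: limr_ge; first exact: cvgP c0.
near=> t.
have t0 : 0 < t by [].
rewrite /= addr0 [t%:A]mulr1 mulr_ge0 ?invr_ge0 ?(ltW t0)// subr_ge0.
by near: t.
Unshelve. all: by end_near. Qed.

Lemma derive_at_global_min phi (D : R) : is_derive (0 : R) (1 : R) phi D ->
  (forall t, phi 0 <= phi t) -> D = 0.
Proof.
move=> dphi min0; apply/eqP; rewrite eq_le; apply/andP; split; last first.
  by apply: derive_ge0_right dphi _; apply: nearW.
rewrite -oppr_ge0; apply: (@derive_ge0_right (phi \o -%R)); last first.
  by apply: nearW => t /=; rewrite oppr0.
have dphi' : is_derive (- (0 : R)) (1 : R) phi D by rewrite oppr0.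
apply: is_derive_eq.
by rewrite mulrN1.
Qed.

(** Taylor's formula with a one-sided bound on the remainder, by integrating
    the bound on the [m]-th derivative [m] times; [phi i] stands for the [i]-th
    derivative of [phi 0]. *)
Lemma taylor_le m (phi : nat -> R -> R) (K : R) :
  (forall i t, (i < m)%N -> is_derive t (1 : R) (phi i) (phi i.+1 t)) ->
  (forall t, 0 <= t <= 1 -> phi m t - phi m 0 <= K * t) ->
  forall t, 0 <= t <= 1 ->
    phi 0%N t - \sum_(i < m.+1) (i`!%:R)^-1 * phi i 0 * t ^+ i
    <= K / (m.+1)`!%:R * t ^+ m.+1.
Proof.
elim: m phi => [|m IH] phi dphi lipm t t01.
  rewrite big_ord1 fact0 (factS 0) fact0 muln1 invr1 mul1r expr0 mulr1 expr1.
  by rewrite mulr1; exact: lipm.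
have {}IH := IH (fun i => phi i.+1) (fun i t im => dphi i.+1 t im) lipm.
pose T t := \sum_(i < m.+2) (i`!%:R)^-1 * phi i 0 * t ^+ i : R.
pose psi t := K / (m.+2)`!%:R * t ^+ m.+2 - (phi 0%N t - T t).
have dX k (s : R) : is_derive s (1 : R) (fun r : R => r ^+ k) (k%:R * s ^+ k.-1).
  apply: DeriveDef; first exact: exprn_derivable.
  by rewrite exp_derive [_ *: 1]mulr1.
have dT s : is_derive s (1 : R) T
    (\sum_(i < m.+1) (i`!%:R)^-1 * phi i.+1 0 * s ^+ i).
  have -> : T = \sum_(i < m.+2) (((i`!%:R)^-1 * phi i 0) \*: (fun t => t ^+ i)).
    by apply/funext => r; rewrite fct_sumE.
  apply: (is_derive_eq (is_derive_sum (fun i => is_deriveZ _ (dX i s)))).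
  rewrite big_ord_recl /= mul0r scaler0 add0r.
  apply: eq_bigr => i _; rewrite /GRing.scale /= factS natrM.
  rewrite /bump add1n add0n; field.
  by rewrite nat1r !pnatr_eq0 -lt0n fact_gt0.
have dpsi s : is_derive s (1 : R) psi (K / (m.+1)`!%:R * s ^+ m.+1 -
    (phi 1%N s - \sum_(i < m.+1) (i`!%:R)^-1 * phi i.+1 0 * s ^+ i)).
  have dK := is_deriveZ (K / (m.+2)`!%:R) (dX m.+2 s).
  apply: (is_derive_eq (is_deriveB dK (is_deriveB (dphi 0%N s isT) (dT s)))).
  congr (_ - _); rewrite /GRing.scale /= [in LHS]factS natrM.
  have m0 : m.+2%:R != 0 :> R by rewrite pnatr_eq0.
  by rewrite invfM (mulrC _^-1) -!mulrA (mulKf m0).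
have : psi 0 <= psi t.
  case/andP: t01 => t0 t1.
  apply: (@ger0_derive1_ndecr _ psi 0 1) => //.
  - move=> s /[!in_itv]/= /andP[s0 s1].
    by have [_ dval] := dpsi s; rewrite derive1E dval subr_ge0 IH// !ltW.
  - by apply: derivable_within_continuous => s _; have [] := dpsi s.
rewrite /psi.
have -> : T 0 = phi 0%N 0.
  rewrite /T big_ord_recl /= fact0 invr1 mul1r expr0 mulr1 big1 ?addr0// => i _.
  by rewrite expr0n mulr0.
by rewrite expr0n mulr0 subrr subr0 subr_ge0.
Qed.
End RealLine.

(** * The Euclidean norm and gradients *)
Section Euclidean.
Variables (R : realType) (n : nat).
Implicit Types (u v w x d h : 'rV[R]_n).

Definition dot u v : R := \sum_(i < n) u 0 i * v 0 i.

Lemma dotC u v : dot u v = dot v u.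
Proof. by apply: eq_bigr => i _; rewrite mulrC. Qed.

Lemma dotDl u v w : dot (u + v) w = dot u w + dot v w.
Proof. by rewrite -big_split; apply: eq_bigr => i _; rewrite mxE mulrDl. Qed.

Lemma dotZl a u v : dot (a *: u) v = a * dot u v.
Proof. by rewrite mulr_sumr; apply: eq_bigr => i _; rewrite mxE mulrA. Qed.

Lemma dot0l v : dot 0 v = 0.
Proof. by rewrite -(scale0r (0 : 'rV[R]_n)) dotZl mul0r. Qed.

Lemma dotNl u v : dot (- u) v = - dot u v.
Proof. by rewrite -scaleN1r dotZl mulN1r. Qed.

Lemma dotDr u v w : dot u (v + w) = dot u v + dot u w.
Proof. by rewrite dotC dotDl !(dotC u). Qed.

Lemma dotZr a u v : dot u (a *: v) = a * dot u v.
Proof. by rewrite dotC dotZl dotC. Qed.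

Lemma dotNr u v : dot u (- v) = - dot u v.
Proof. by rewrite dotC dotNl dotC. Qed.

Definition dotE := (dotDl, dotDr, dotNl, dotNr, dotZl, dotZr).

Lemma dot_ge0 u : 0 <= dot u u.
Proof. by apply: sumr_ge0 => i _; rewrite -expr2 sqr_ge0. Qed.

Lemma norm2_ge0 u : 0 <= norm2 u. Proof. exact: sqrtr_ge0. Qed.

Lemma norm2E u : norm2 u = Num.sqrt (dot u u).
Proof. by []. Qed.

Lemma sqr_norm2 u : norm2 u ^+ 2 = dot u u.
Proof. by rewrite norm2E sqr_sqrtr// dot_ge0. Qed.

Lemma norm2_eq0 u : norm2 u = 0 -> u = 0.
Proof.
move=> u0; have /eqP := sqr_norm2 u; rewrite u0 expr0n eq_sym psumr_eq0; last first.
  by move=> i _; rewrite -expr2 sqr_ge0.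
move=> /allP z; apply/rowP => i; rewrite mxE; apply/eqP.
by have := z i (mem_index_enum i); rewrite /= mulf_eq0 orbb.
Qed.

Lemma norm2Z a u : norm2 (a *: u) = `|a| * norm2 u.
Proof.
by rewrite !norm2E dotZl dotZr mulrA -expr2 sqrtrM ?sqr_ge0// sqrtr_sqr.
Qed.

Lemma norm2N u : norm2 (- u) = norm2 u.
Proof. by rewrite -scaleN1r norm2Z normrN1 mul1r. Qed.

Lemma norm2_0 : norm2 (0 : 'rV[R]_n) = 0.
Proof. by rewrite -(scale0r 0) norm2Z normr0 mul0r. Qed.

(** Expand [0 <= | |v| u - |u| v |^2]. *)
Lemma cauchy_schwarz u v : dot u v <= norm2 u * norm2 v.
Proof.
have u0 := norm2_ge0 u; have v0 := norm2_ge0 v.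
have [/norm2_eq0 -> |u1] := eqVneq (norm2 u) 0.
  by rewrite dot0l mulr_ge0// norm2_ge0.
have [/norm2_eq0 -> |v1] := eqVneq (norm2 v) 0.
  by rewrite dotC dot0l mulr_ge0// norm2_ge0.
have := dot_ge0 (norm2 v *: u - norm2 u *: v).
have -> : dot (norm2 v *: u - norm2 u *: v) (norm2 v *: u - norm2 u *: v) =
    norm2 u * norm2 v * ((norm2 u * norm2 v - dot u v) *+ 2).
  by rewrite !dotE -!sqr_norm2 (dotC v u); ring.
by rewrite pmulr_rge0 ?pmulrn_lge0 ?subr_ge0// mulr_gt0// lt0r ?u1 ?v1.
Qed.

(** The factor [norm2 v] is split off because the norm of a multilinear form
    only speaks of the unit ball; the zero vector is written [0 *: 0]. *)
Lemma norm2_polar v : exists2 w, v = norm2 v *: w & norm2 w <= 1.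
Proof.
have [v0|v0] := eqVneq (norm2 v) 0.
  by exists 0; rewrite ?norm2_0 ?ler01// v0 scale0r; exact: norm2_eq0.
exists ((norm2 v)^-1 *: v); first by rewrite scalerA mulfV// scale1r.
by rewrite norm2Z gtr0_norm ?invr_gt0 ?lt0r ?v0 ?norm2_ge0// mulVf.
Qed.

Lemma dot_grad (f : 'rV[R]_n -> R) x h : differentiable f x ->
  dot (grad f x) h = 'D_h f x.
Proof.
move=> df; rewrite [in RHS](row_sum_delta h) deriveE// linear_sum.
by apply: eq_bigr => i _; rewrite linearZ mxE /= deriveE// mulrC.
Qed.

(** The gap between the chord and the function is nonnegative on [[0, 1]] and
    vanishes at [0], so its derivative there is nonnegative. *)
Lemma convex_gradient_le (f : 'rV[R]_n -> R) x y :
  convex_function [set: 'rV[R]_n] f -> differentiable f x ->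
  f x + dot (grad f x) (y - x) <= f y.
Proof.
move=> cf df; rewrite dot_grad//.
have df0 : differentiable f (x + (0 : R) *: (y - x)) by rewrite scale0r addr0.
have dl := is_derive_along_line df0; rewrite scale0r addr0 in dl.
pose phi t : R := (1 - t) * f x + t * f y - f (x + t *: (y - x)).
have dphi : is_derive (0 : R) (1 : R) phi (f y - f x - 'D_(y - x) f x).
  have -> : phi = ((cst 1 - id) * cst (f x) + id * cst (f y)) -
      (fun t : R => f (x + t *: (y - x))) by apply/funext.
  have d1 := is_deriveB (is_derive_cst (1 : R) (0 : R) (1 : R)) (is_derive_id (0 : R) (1 : R)).
  have d2 := is_deriveM d1 (is_derive_cst (f x) (0 : R) (1 : R)).
  have d3 := is_deriveM (is_derive_id (0 : R) (1 : R)) (is_derive_cst (f y) (0 : R) (1 : R)).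
  apply: (is_derive_eq (is_deriveB (is_deriveD d2 d3) dl)).
  move: (f y) (f x) ('D_(y - x) f x) => a b c.
  by rewrite /GRing.scale /= !mulr0 !add0r !mulr1 mulrN1 (addrC (- b)).
suff : 0 <= f y - f x - 'D_(y - x) f x by lra.
apply: (derive_ge0_right dphi).
near=> t; rewrite {1}/phi scale0r addr0 subr0 mul1r mul0r addr0 subrr.
have t0 : 0 < t by [].
have t1 : t <= 1 by near: t; apply: nbhs_right_le.
have t01 : 0 <= t <= 1 by rewrite ltW.
rewrite subr_ge0.
have xE : x + t *: (y - x) = t *: y + (1 - t) *: x.
  by rewrite scalerBr scalerBl scale1r addrCA.
have := cf (Itv01 (ltW t0) t1) y x (in_setT _) (in_setT _).
by rewrite convRE /= addrC xE.
Unshelve. all: by end_near. Qed.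

End Euclidean.

(** * The proximal term and the powers of the norm *)
Section Quadratic.
Variables (R : realType) (n : nat).
Implicit Types (c d h k x z : 'rV[R]_n).

Lemma differentiable_dotl c h z : differentiable (fun z => dot (z - c) h) z.
Proof.
have -> : (fun z => dot (z - c) h) =
    \sum_(i < n) (fun z : 'rV[R]_n => (z 0 i - c 0 i) * h 0 i).
  by apply/funext => y; rewrite fct_sumE; apply: eq_bigr => i _; rewrite !mxE.
apply: differentiable_sum => i; apply: differentiableM => //.
by apply: differentiableB => //; exact: differentiable_coord.
Qed.

Lemma differentiable_sqr_norm2 c z : differentiable (fun z => dot (z - c) (z - c)) z.
Proof.
have -> : (fun z => dot (z - c) (z - c)) =
    \sum_(i < n) (fun z : 'rV[R]_n => (z 0 i - c 0 i) * (z 0 i - c 0 i)).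
  by apply/funext => y; rewrite fct_sumE; apply: eq_bigr => i _; rewrite !mxE.
apply: differentiable_sum => i; apply: differentiableM;
  by apply: differentiableB => //; exact: differentiable_coord.
Qed.

Lemma is_derive_quadratic (a b e : R) :
  is_derive (0 : R) (1 : R) (fun t : R => e + t * a + t ^+ 2 * b) a.
Proof.
have d1 := is_deriveM (is_derive_id (0 : R) (1 : R)) (is_derive_cst a (0 : R) (1 : R)).
have d2 := is_deriveM (is_deriveX 2 (is_derive_id (0 : R) (1 : R)))
  (is_derive_cst b (0 : R) (1 : R)).
apply: (is_derive_eq (is_deriveD (is_deriveD (is_derive_cst e (0 : R) (1 : R)) d1) d2)).
by rewrite /GRing.scale /= expr0n /= !(mulr0, mul0r) !add0r mulr1 addr0.
Qed.

(** Reads off a directional derivative from an exact second-order expansion. *)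
Lemma derive_quadratic (f : 'rV[R]_n -> R) z h (a b : R) : differentiable f z ->
  (forall t, f (z + t *: h) = f z + t * a + t ^+ 2 * b) -> 'D_h f z = a.
Proof.
move=> df fE; have df0 : differentiable f (z + (0 : R) *: h).
  by rewrite scale0r addr0.
have := is_derive_along_line df0; rewrite scale0r addr0.
rewrite (_ : (fun s => _) = (fun t => f z + t * a + t ^+ 2 * b)); last exact/funext.
by move=> [_ <-]; have [_] := is_derive_quadratic a b (f z).
Qed.

Lemma times_differentiable_cst p (a : R) :
  times_differentiable p (fun _ : 'rV[R]_n => a).
Proof.
elim: p a => [//|p IH] a; split=> [x|h]; first exact: differentiable_cst.
have -> : (fun x => 'D_h (fun _ : 'rV[R]_n => a) x) = fun=> 0.
  by apply/funext => x; exact: derive_cst.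
exact: IH.
Qed.

Section Proximal.
Variables (L : R) (c : 'rV[R]_n).
Let q z : R := L / 2 * norm2 (z - c) ^+ 2.

Lemma differentiable_prox z : differentiable q z.
Proof.
rewrite /q (_ : (fun z => _) = (L / 2) *: (fun z => dot (z - c) (z - c))).
  by apply: differentiableZ; exact: differentiable_sqr_norm2.
by apply/funext => y; rewrite sqr_norm2.
Qed.

Lemma derive_prox h z : 'D_h q z = L * dot (z - c) h.
Proof.
apply: (@derive_quadratic _ _ _ _ (L / 2 * dot h h) (differentiable_prox z)) => t.
rewrite /q !sqr_norm2 (addrAC z); move: (z - c) => w.
by rewrite !dotE (dotC h w); field.
Qed.

Lemma derive_dotl a k h z : 'D_k (fun z => a * dot (z - c) h) z = a * dot k h.
Proof.
have da : differentiable (fun z => a * dot (z - c) h) z.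
  rewrite (_ : (fun z => _) = a *: (fun z => dot (z - c) h)); last exact/funext.
  by apply: differentiableZ; exact: differentiable_dotl.
apply: (@derive_quadratic _ _ _ _ 0 da) => t; rewrite (addrAC z) (dotDl (z - c)) dotZl.
by ring.
Qed.

Lemma times_differentiable_prox p : times_differentiable p q.
Proof.
case: p => [//|p]; split=> [z|h]; first exact: differentiable_prox.
have -> : (fun z => 'D_h q z) = (fun z => L * dot (z - c) h).
  by apply/funext => z; exact: derive_prox.
case: p => [//|p]; split=> [z|k].
  rewrite (_ : (fun z => _) = L *: (fun z => dot (z - c) h)); last exact/funext.
  by apply: differentiableZ; exact: differentiable_dotl.
rewrite (_ : (fun x => _) = fun=> L * dot k h); last first.
  by apply/funext => z; exact: derive_dotl.
exact: times_differentiable_cst.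
Qed.

(** At its centre the proximal term has a single nonzero derivative, the second;
    for [p = 1] the Taylor model therefore does not see it. *)
Lemma dirder_prox i d h : dirder q (nseq i d ++ [:: h]) c = L * dot d h *+ (i == 1)%N.
Proof.
case: i => [|[|i]].
- by rewrite /= derive_prox /= subrr dot0l mulr0.
- by rewrite /=; have /funext -> := derive_prox h; rewrite derive_dotl.
have cst0 (k : nat) (a : R) x :
    dirder (fun _ : 'rV[R]_n => a) (nseq k.+1 d) x = 0.
  elim: k x => [|k IH] x /=; first by rewrite derive_cst.
  have -> : (fun x => 'D_d (dirder (fun=> a) (nseq k d)) x) = fun=> 0.
    by apply/funext => y; exact: IH.
  by rewrite derive_cst.
have -> : nseq i.+2 d ++ [:: h] = nseq i.+1 d ++ [:: d; h].
  by rewrite -(addn1 i.+1) nseqD -catA.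
rewrite dirder_cat; have -> : dirder q [:: d; h] = fun=> L * dot d h.
  by apply/funext => z /=; have /funext -> := derive_prox h; rewrite derive_dotl.
exact: cst0.
Qed.
End Proximal.

(** The square root is not differentiable at [0], whence the hypothesis on [d];
    the square of the norm, [p = 1], is a polynomial and escapes it. *)
Lemma is_derive_norm2X p d h : (0 < p)%N -> ((1 < p)%N -> norm2 d != 0) ->
  is_derive (0 : R) (1 : R) (fun t : R => norm2 (d + t *: h) ^+ p.+1)
    (p.+1%:R * norm2 d ^+ p.-1 * dot d h).
Proof.
move=> p0 d0.
have nE (t : R) : dot (d + t *: h) (d + t *: h) =
    dot d d + t * (dot d h *+ 2) + t ^+ 2 * dot h h.
  by rewrite !dotE (dotC h d); ring.
have ds := is_derive_quadratic (dot d h *+ 2) (dot h h) (dot d d).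
have [p1|p1] := leqP p 1.
  have -> : p = 1%N by apply/eqP; rewrite eqn_leq p1.
  rewrite (_ : (fun t => _) =
    (fun t : R => dot d d + t * (dot d h *+ 2) + t ^+ 2 * dot h h)); last first.
    by apply/funext => t; rewrite sqr_norm2 nE.
  by apply: (is_derive_eq ds); rewrite expr0 mulr1 mulr_natl.
have dp : 0 < norm2 d by rewrite lt0r d0// norm2_ge0.
set s := (fun t : R => _) in ds.
have s0 : s 0 = dot d d by rewrite /s mul0r expr0n mul0r !addr0.
have dsqrt : is_derive (s 0) (1 : R) Num.sqrt (2 * norm2 d)^-1.
  by rewrite s0 norm2E; apply: is_derive1_sqrt; rewrite -sqr_norm2 exprn_gt0.
rewrite (_ : (fun t => _) = (Num.sqrt \o s) ^+ p.+1); last first.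
  by apply/funext => t; rewrite norm2E nE exprfctE.
have dc := @is_derive1_comp _ _ _ _ _ _ dsqrt ds.
apply: (is_derive_eq (is_deriveX p.+1 dc)).
have pE : norm2 d ^+ p = norm2 d ^+ p.-1 * norm2 d by rewrite -exprSr prednK.
rewrite /= s0 -norm2E /GRing.scale /= pE.
by field; rewrite gt_eqF.
Qed.

End Quadratic.

(** * The tensor step *)
Section TensorStep.
Variables (R : realType) (n : nat).
Implicit Types (f g : 'rV[R]_n -> R) (d e h x y : 'rV[R]_n).

(** Fermat's rule for the model along the line through [y] with direction [h]. *)
Lemma tensor_step_stationary p (K : R) g x y h : (0 < p)%N ->
  times_differentiable p g -> is_tensor_step p K g x y ->
  ((1 < p)%N -> norm2 (y - x) != 0) ->
  \sum_(i < p) (i`!%:R)^-1 * dirder g (nseq i (y - x) ++ [:: h]) x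
  + K / p`!%:R * norm2 (y - x) ^+ p.-1 * dot (y - x) h = 0.
Proof.
move=> p0 gp step d0; set d := y - x in d0 *.
pose psi (t : R) := tensor_model p K g x (y + t *: h).
pose T := \sum_(r < p.+1) (r`!%:R^-1 \*: (fun t : R => dirder g (nseq r (d + t *: h)) x)).
pose reg := (K / (p.+1)`!%:R) \*: (fun t : R => norm2 (d + t *: h) ^+ p.+1).
have psiE : psi = T + reg.
  apply/funext => t; rewrite /psi /tensor_model /T /reg addrAC -/d.
  by rewrite -[RHS]/(_ t + _ t) fct_sumE.
have dT : is_derive (0 : R) (1 : R) T
    (\sum_(r < p.+1) r`!%:R^-1 * (r%:R * dirder g (nseq r.-1 d ++ [:: h]) x)).
  apply: is_derive_sum => r; apply: is_deriveZ.
  by apply: (is_derive_dirder_nseq (s := [::]) _ _ _ gp); rewrite -ltnS ltn_ord.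
have dpsi : is_derive (0 : R) (1 : R) psi
    (\sum_(r < p.+1) r`!%:R^-1 * (r%:R * dirder g (nseq r.-1 d ++ [:: h]) x)
     + K / (p.+1)`!%:R * (p.+1%:R * norm2 d ^+ p.-1 * dot d h)).
  by rewrite psiE; exact: (is_deriveD dT (is_deriveZ _ (is_derive_norm2X h p0 d0))).
have psi_min (t : R) : psi 0 <= psi t by rewrite /psi scale0r addr0; exact: step.
rewrite -[RHS](derive_at_global_min dpsi psi_min).
rewrite big_ord_recl mul0r mulr0 add0r; congr (_ + _).
  apply: eq_bigr => i _; rewrite /= /bump add1n factS natrM invfM.
  by rewrite -mulrA mulrCA mulKf// pnatr_eq0.
rewrite factS natrM invfM -!mulrA; congr (_ * _).
by rewrite [RHS]mulrCA mulKf// pnatr_eq0.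
Qed.

(** Only unit directions enter the norm of a form; multilinearity restores the
    lengths of [d] and [h]. *)
Lemma dirder_lipschitz k (M : R) f d h x y : times_differentiable k.+1 f ->
  lipschitz_dirder k.+1 M f ->
  dirder f (nseq k d ++ [:: h]) x - dirder f (nseq k d ++ [:: h]) y
  <= M * norm2 d ^+ k * norm2 h * norm2 (x - y).
Proof.
move=> fk lipf.
have [e de e1] := norm2_polar d; have [w hw w1] := norm2_polar h.
have hE z : dirder f (nseq k d ++ [:: h]) z =
    norm2 d ^+ k * (norm2 h * dirder f (nseq k e ++ [:: w]) z).
  rewrite {1}de (dirder_nseqZ (s1 := [::]) _ _ _ fk) /= ?addn1//.
  by rewrite {1}hw (dirderZ _ _ _ fk)//= size_nseq addn0.
have sz : size (nseq k e ++ [:: w]) == k.+1 by rewrite size_cat size_nseq addn1.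
have unit_le : dirder f (nseq k e ++ [:: w]) x - dirder f (nseq k e ++ [:: w]) y
    <= M * norm2 (x - y).
  rewrite -lee_fin; apply: le_trans (lipf x y); apply: ereal_sup_ubound.
  exists (Tuple sz) => //= i; rewrite (tnth_nth 0) /= nth_cat size_nseq nth_nseq.
  case: ltnP => // ki; rewrite [nth _ _ _](_ : _ = w)//.
  by have := ltn_ord i; rewrite ltnS => ik; have -> : (i - k = 0)%N by apply/eqP.
rewrite !hE -mulrBr -mulrBr.
have -> : M * norm2 d ^+ k * norm2 h * norm2 (x - y) =
  norm2 d ^+ k * (norm2 h * (M * norm2 (x - y))) by ring.
by rewrite ler_wpM2l ?exprn_ge0 ?norm2_ge0// ler_wpM2l ?norm2_ge0.
Qed.

(** Taylor's formula along the segment from [x] to [y], for ['D_h f] instead of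
    [f]: the sum is the gradient of the Taylor polynomial of [f], paired with [h],
    as [tensor_step_stationary] produces it. *)
Lemma derive_taylor_le p (M : R) f x y h : (0 < p)%N -> times_differentiable p f ->
  lipschitz_dirder p M f ->
  'D_h f y - \sum_(i < p) (i`!%:R)^-1 * dirder f (nseq i (y - x) ++ [:: h]) x
  <= M / p`!%:R * norm2 (y - x) ^+ p * norm2 h.
Proof.
case: p => [//|m] _ fp lipf; set d := y - x.
pose phi i (t : R) := dirder f (nseq i d ++ [:: h]) (x + t *: d).
have dphi i t : (i < m)%N -> is_derive t (1 : R) (phi i) (phi i.+1 t).
  move=> im; apply: is_derive_along_line; apply: (differentiable_dirder _ fp).
  by rewrite size_cat size_nseq addn1.
have lipm t : 0 <= t <= 1 ->
    phi m t - phi m 0 <= M * norm2 d ^+ m.+1 * norm2 h * t.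
  move=> /andP[t0 _]; apply: (le_trans (dirder_lipschitz _ _ _ _ fp lipf)).
  rewrite scale0r addr0 addrC addKr norm2Z ger0_norm// exprSr.
  by rewrite le_eqVlt; apply/orP; left; apply/eqP; ring.
have := taylor_le dphi lipm (t := 1); rewrite ler01 lexx => /(_ isT).
have -> : phi 0%N 1 = 'D_h f y by rewrite /phi scale1r (addrC x) subrK.
rewrite expr1n mulr1.
under eq_bigr do rewrite expr1n mulr1 /phi scale0r addr0.
by move/le_trans; apply; rewrite le_eqVlt; apply/orP; left; apply/eqP; ring.
Qed.

End TensorStep.

Section Residual.
Variables (R : realType) (n : nat).
Implicit Types (f : 'rV[R]_n -> R) (d e h x y : 'rV[R]_n).

Lemma norm2_le_dot e (C : R) : 0 <= C -> (forall h, dot e h <= C * norm2 h) ->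
  norm2 e <= C.
Proof.
move=> C0 eC; have [->//|e0] := eqVneq (norm2 e) 0.
have e1 : 0 < norm2 e by rewrite lt0r e0 norm2_ge0.
by rewrite -(ler_pM2r e1) -expr2 sqr_norm2 eC.
Qed.

(** Up to the Taylor error, [grad f y] is the gradient of the Taylor polynomial of
    [f], which stationarity of the model expresses through the gradients of the
    two penalties. For [p = 1] the model of the proximal term at its own
    centre is [0], so that only the higher-order penalty remains. *)
Lemma tensor_step_grad p (M L : R) f x y h : (0 < p)%N ->
  times_differentiable p f -> lipschitz_dirder p M f ->
  is_tensor_step p (p%:R * M) (regularized f L x) x y ->
  ((1 < p)%N -> norm2 (y - x) != 0) ->
  dot (grad f y) h <= M / p`!%:R * norm2 (y - x) ^+ p * norm2 h
    - p%:R * M / p`!%:R * norm2 (y - x) ^+ p.-1 * dot (y - x) h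
    - L * dot (y - x) h *+ (1 < p)%N.
Proof.
move=> p0 fp lipf step d0; set d := y - x in d0 *.
have qp := times_differentiable_prox L x p.
have Fp : times_differentiable p (regularized f L x) by exact: times_differentiableD.
have dfy : differentiable f y := differentiable_dirder (s := [::]) y fp p0.
have := tensor_step_stationary h p0 Fp step d0; rewrite -/d.
have -> : \sum_(i < p) i`!%:R^-1 * dirder (regularized f L x) (nseq i d ++ [:: h]) x
    = \sum_(i < p) i`!%:R^-1 * dirder f (nseq i d ++ [:: h]) x
      + L * dot d h *+ (1 < p)%N.
  under eq_bigr => i _.
    rewrite (dirderD _ fp qp); last by rewrite size_cat size_nseq addn1.
    rewrite dirder_prox mulrDr; over.
  rewrite big_split /=; congr (_ + _).
  have [p1|p1] := ltnP 1 p.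
    rewrite (bigD1 (Ordinal p1))//= big1 ?addr0 => [|i]; first last.
      by rewrite -val_eqE /= => /negbTE ->; rewrite mulr0.
    by rewrite (factS 0) fact0 invr1 mul1r.
  rewrite big1// => i _; rewrite ltn_eqF ?mulr0//.
  exact: leq_trans (ltn_ord i) p1.
have := derive_taylor_le x y h p0 fp lipf; rewrite -/d -dot_grad//; lra.
Qed.

(** [L * (y - x)] is exactly the gradient of the proximal term, so the residual of
    the proximal equation consists of the Taylor error, [M / p! * |d|^p], and of
    the gradient of the penalty, [p * M / p! * |d|^p]. *)
Lemma tensor_step_residual p (M L : R) f x y : (1 < p)%N -> 0 <= M ->
  times_differentiable p f -> lipschitz_dirder p M f ->
  is_tensor_step p (p%:R * M) (regularized f L x) x y -> norm2 (y - x) != 0 ->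
  norm2 (grad f y + L *: (y - x)) <= (p%:R + 1) * M / p`!%:R * norm2 (y - x) ^+ p.
Proof.
move=> p1 M0 fp lipf step d0; have p0 : (0 < p)%N := ltnW p1.
apply: norm2_le_dot => [|h].
  by rewrite mulr_ge0 ?exprn_ge0 ?norm2_ge0// divr_ge0// mulr_ge0.
rewrite dotDl dotZl.
have := tensor_step_grad h p0 fp lipf step (fun _ => d0).
set d := y - x; rewrite p1 mulr1n.
have : - dot d h <= norm2 d * norm2 h.
  by rewrite -dotNl -(norm2N d); exact: cauchy_schwarz.
have K0 : 0 <= p%:R * M / p`!%:R * norm2 d ^+ p.-1.
  by rewrite mulr_ge0 ?exprn_ge0 ?norm2_ge0// divr_ge0// mulr_ge0.
move=> /(ler_wpM2l K0).
have -> : norm2 d ^+ p = norm2 d ^+ p.-1 * norm2 d by rewrite -exprSr prednK.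
move: (p`!%:R^-1) (norm2 d ^+ p.-1) (norm2 d) (norm2 h) (dot d h) (dot (grad f y) h).
by move=> k a b c e g; lra.
Qed.

(** For [p = 1] the term [L * (y - x)] is only partly cancelled by the penalty:
    [L - M] times the step is left, to which the Taylor error adds [M]. *)
Lemma gradient_step_residual (M L : R) f x y : 0 <= M -> M <= L ->
  times_differentiable 1 f -> lipschitz_dirder 1 M f ->
  is_tensor_step 1 (1%:R * M) (regularized f L x) x y ->
  norm2 (grad f y + L *: (y - x)) <= L * norm2 (y - x).
Proof.
move=> M0 ML fp lipf step; have L0 : 0 <= L := le_trans M0 ML.
apply: norm2_le_dot => [|h]; first by rewrite mulr_ge0// norm2_ge0.
rewrite dotDl dotZl.
have d0 : (1 < 1)%N -> norm2 (y - x) != 0 by [].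
have := tensor_step_grad h (isT : (0 < 1)%N) fp lipf step d0.
set d := y - x; rewrite mulr0n (factS 0) fact0 expr0 expr1 invr1 subr0.
have : (L - M) * dot d h <= (L - M) * (norm2 d * norm2 h).
  by rewrite ler_wpM2l ?subr_ge0//; exact: cauchy_schwarz.
lra.
Qed.

End Residual.

(** * The accelerated proximal scheme *)
Section Acceleration.
Variables (R : realType) (n : nat).
Implicit Types (f : 'rV[R]_n -> R) (u x y xs : 'rV[R]_n).

(** Inexact accelerated proximal point step: [grad f y' + L (y' - x)] is the
    residual of the proximal equation at [y'], and [s] its relative size. Convexity
    at [y] and at [xs] leaves [a^2 |g|^2 / 2 + (A + a) <g, y' - x>], where
    [g = grad f y'], as the only terms that can increase the potential. The
    choice [L a^2 = A + a] makes them [(A + a) / (2 L)] times the difference of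
    the squared residual and [L^2 |y' - x|^2]. *)
Lemma accelerated_step f xs (A a L s : R) u x y y' :
  convex_function [set: 'rV[R]_n] f -> differentiable f y' ->
  0 <= A -> 0 < a -> 0 < L -> L * a ^+ 2 = A + a ->
  x = (A / (A + a)) *: y + (a / (A + a)) *: u ->
  norm2 (grad f y' + L *: (y' - x)) <= s * L * norm2 (y' - x) ->
  (A + a) * (f y' - f xs) + norm2 (u - a *: grad f y' - xs) ^+ 2 / 2
  + (1 - s ^+ 2) / 2 * ((A + a) * L * norm2 (y' - x) ^+ 2)
  <= A * (f y - f xs) + norm2 (u - xs) ^+ 2 / 2.
Proof.
move=> cf df A0 a0 L0 La xE res; set g := grad f y' in res *.
have A'0 : 0 < A + a by rewrite ltr_wpDl.
have cy := convex_gradient_le y cf df; have cs := convex_gradient_le xs cf df.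
rewrite -/g in cy cs; set d := y' - x in res *.
have comb : A * dot g (y - y') + a * dot g (xs - y') =
    - ((A + a) * dot g d) - a * dot g (u - xs).
  have -> : (A + a) * dot g d = (A + a) * dot g y' - (A * dot g y + a * dot g u).
    by rewrite /d xE !dotE; field; rewrite gt_eqF.
  by rewrite !dotE; ring.
clearbody d.
have {}res : (A + a) * dot g g <=
    (A + a) * (L * ((s ^+ 2 - 1) * L * dot d d - 2 * dot g d)).
  rewrite ler_pM2l//.
  have : norm2 (g + L *: d) ^+ 2 <= (s * L * norm2 d) ^+ 2.
    by rewrite ler_sqr ?nnegrE ?norm2_ge0// (le_trans _ res)// norm2_ge0.
  rewrite exprMn !sqr_norm2 !dotE (dotC d g); lra.
have {}res : a ^+ 2 * dot g g <= (A + a) * ((s ^+ 2 - 1) * L * dot d d - 2 * dot g d).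
  rewrite -(ler_pM2l L0) mulrA La; apply: (le_trans res).
  by rewrite le_eqVlt; apply/orP; left; apply/eqP; ring.
have uE : norm2 (u - a *: g - xs) ^+ 2 =
    norm2 (u - xs) ^+ 2 - 2 * (a * dot g (u - xs)) + a ^+ 2 * dot g g.
  rewrite addrAC !sqr_norm2; move: (u - xs) => w.
  by rewrite !dotE (dotC w g); ring.
rewrite uE -!(sqr_norm2 d) in res *.
move: cy => /(ler_wpM2l A0); move: cs => /(ler_wpM2l (ltW a0)).
move: comb res; rewrite !mulrDr.
set P := A * dot _ _; set Q := a * dot _ _; set S := a * dot _ _; set r := norm2 d ^+ 2.
set G := a ^+ 2 * _; set H := dot g d.
move=> comb res; lra.
Qed.

End Acceleration.

Section Potential.
Variable R : realType.

(** [a] is the positive root of [L a^2 - a - A]. *)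
Lemma step_weight (A L a : R) : 0 <= A -> 0 < L ->
  a = (L^-1 + Num.sqrt ((L ^+ 2)^-1 + 4 * A / L)) / 2 ->
  0 < a /\ L * a ^+ 2 = A + a.
Proof.
move=> A0 L0 aE; have Li : 0 < L^-1 by rewrite invr_gt0.
have D0 : 0 <= (L ^+ 2)^-1 + 4 * A / L.
  by rewrite addr_ge0 ?invr_ge0 ?exprn_ge0 ?(ltW L0)// mulr_ge0 ?(ltW Li)// mulr_ge0.
have S0 := sqrtr_ge0 ((L ^+ 2)^-1 + 4 * A / L).
have SE := sqr_sqrtr D0.
set S := Num.sqrt _ in aE S0 SE; split; first by rewrite aE; lra.
have {}SE : S ^+ 2 = L^-1 ^+ 2 + 4 * A * L^-1 by rewrite SE exprVn.
have LLi : L * L^-1 = 1 by rewrite mulfV// gt_eqF.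
have -> : L * a ^+ 2 = (L * L^-1 * (L^-1 + S *+ 2) + L * S ^+ 2) / 4.
  by rewrite aE; field; rewrite gt_eqF.
rewrite SE.
have -> : L * (L^-1 ^+ 2 + 4 * A * L^-1) = (L * L^-1) * L^-1 + 4 * A * (L * L^-1) by ring.
by rewrite LLi aE; field; rewrite gt_eqF.
Qed.

(** With [c = sqrt (A + a)] one has [c = a * sqrt L], so the increment
    [a / (c + sqrt A)] of the square root is at least [a / (2 c)]. *)
Lemma sqrt_step_weight (A L a : R) : 0 <= A -> 0 < L -> 0 < a ->
  L * a ^+ 2 = A + a -> Num.sqrt A + (2 * Num.sqrt L)^-1 <= Num.sqrt (A + a).
Proof.
move=> A0 L0 a0 La; have A'0 : 0 < A + a by rewrite ltr_wpDl.
set l := Num.sqrt L; set b := Num.sqrt A; set c := Num.sqrt (A + a).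
have l0 : 0 < l by rewrite sqrtr_gt0.
have b0 : 0 <= b by exact: sqrtr_ge0.
have c0 : 0 < c by rewrite sqrtr_gt0.
have cE : c = l * a by rewrite /c -La sqrtrM ?(ltW L0)// sqrtr_sqr gtr0_norm.
have bc : b <= c by rewrite ler_wsqrtr// lerDl ltW.
have b2 : b ^+ 2 = A by rewrite sqr_sqrtr.
have c2 : c ^+ 2 = A + a by rewrite sqr_sqrtr// ltW.
have -> : (2 * l)^-1 = a / (2 * c) by rewrite cE; field; rewrite !gt_eqF.
rewrite -lerBrDl ler_pdivrMr ?mulr_gt0//.
have -> : a = (c - b) * (c + b).
  by transitivity (c ^+ 2 - b ^+ 2); [rewrite c2 b2; ring | ring].
by rewrite ler_wpM2l ?subr_ge0//; lra.
Qed.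

Variables (n p N : nat) (M : R) (f : 'rV[R]_n -> R) (xs : 'rV[R]_n).
Variables (L a A : nat -> R) (x y u : nat -> 'rV[R]_n).
Hypothesis otm : optimal_tensor_method p M f N L a A x y u.

Lemma otm_weights k : (k <= N)%N -> 0 <= A k /\ forall j, (j < k)%N ->
  [/\ 0 <= A j, 0 < a j.+1 & L j * a j.+1 ^+ 2 = A j + a j.+1].
Proof.
elim: k => [|k IH] kN; first by rewrite (otm_A0 otm).
have [Ak IHk] := IH (ltnW kN).
have [a0 La] := step_weight Ak (otm_L_gt0 otm kN) (otm_a otm kN).
split=> [|j]; first by rewrite (otm_A otm kN) addr_ge0// ltW.
by rewrite ltnS leq_eqVlt => /predU1P[->|/IHk].
Qed.

Lemma otm_sqrt_A k : (k < N)%N ->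
  Num.sqrt (A k) + (2 * Num.sqrt (L k))^-1 <= Num.sqrt (A k.+1).
Proof.
move=> kN; have [_ /(_ k (leqnn _))[A0 a0 La]] := otm_weights kN.
by rewrite (otm_A otm kN) sqrt_step_weight// (otm_L_gt0 otm).
Qed.

Lemma otm_A_gt0 k : (k < N)%N -> 0 < A k.+1.
Proof.
move=> kN; have [_ /(_ k (leqnn _))[A0 a0 La]] := otm_weights kN.
by rewrite (otm_A otm kN) ltr_wpDl.
Qed.

(** Telescoping [accelerated_step]. *)
Lemma otm_potential (s : R) :
  convex_function [set: 'rV[R]_n] f -> (forall z, differentiable f z) ->
  (forall k, (k < N)%N ->
    norm2 (grad f (y k.+1) + L k *: (y k.+1 - x k)) <=
    s * L k * norm2 (y k.+1 - x k)) ->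
  A N * (f (y N) - f xs)
  + (1 - s ^+ 2) / 2 * \sum_(k < N) A k.+1 * L k * norm2 (y k.+1 - x k) ^+ 2
  <= norm2 (u 0%N - xs) ^+ 2 / 2.
Proof.
move=> cf df res.
suff potk k : (k <= N)%N -> A k * (f (y k) - f xs) + norm2 (u k - xs) ^+ 2 / 2
    + (1 - s ^+ 2) / 2 * \sum_(j < k) A j.+1 * L j * norm2 (y j.+1 - x j) ^+ 2
    <= norm2 (u 0%N - xs) ^+ 2 / 2.
  by have := potk N (leqnn N); have := sqr_ge0 (norm2 (u N - xs)); lra.
elim: k => [|k IH] kN; first by rewrite (otm_A0 otm) mul0r add0r big_ord0 mulr0 addr0.
have [_ /(_ k (leqnn _))[A0 a0 La]] := otm_weights kN.
have xk := otm_x otm kN; have uk := otm_u otm kN.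
rewrite big_ord_recr /= mulrDr; move: xk; rewrite (otm_A otm kN) => xk.
have := accelerated_step xs cf (df (y k.+1)) A0 a0 (otm_L_gt0 otm kN) La xk (res k kN).
rewrite -uk; have := IH (ltnW kN); lra.
Qed.

End Potential.

(** * Growth of the weights *)
Section PowerInequalities.
Variable R : realType.
Implicit Types (a s t x al th : R).

Lemma le_powRl s t x : 0 <= x -> 0 <= s -> s <= t -> s `^ x <= t `^ x.
Proof.
by move=> x0 s0 st; apply: ge0_ler_powR; rewrite ?nnegrE ?(le_trans s0 st).
Qed.

(** By induction from the case of two summands. *)
Lemma sum_hoelder (X Y : nat -> R) al m : 0 < al < 1 ->
  (forall j, (j < m)%N -> 0 <= X j) -> (forall j, (j < m)%N -> 0 <= Y j) ->
  \sum_(j < m) X j `^ al * Y j `^ (1 - al) <=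
  (\sum_(j < m) X j) `^ al * (\sum_(j < m) Y j) `^ (1 - al).
Proof.
move=> /andP[al0 al1]; elim: m => [|m IH] X0 Y0.
  by rewrite !big_ord0 mulr_ge0// powR_ge0.
have be0 : 0 < 1 - al by rewrite subr_gt0.
have sX : 0 <= \sum_(j < m) X j.
  by apply: sumr_ge0 => j _; rewrite X0// ltnS ltnW.
have sY : 0 <= \sum_(j < m) Y j.
  by apply: sumr_ge0 => j _; rewrite Y0// ltnS ltnW.
rewrite !big_ord_recr /=; apply: le_trans (lerD (IH _ _) (lexx _)) _.
- by move=> j jm; rewrite X0// ltnS ltnW.
- by move=> j jm; rewrite Y0// ltnS ltnW.
have powK c z : 0 < c -> 0 <= z -> (z `^ c) `^ c^-1 = z.
  by move=> c0 z0; rewrite -powRrM mulfV ?gt_eqF// powRr1.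
have := @hoelder2 R ((\sum_(j < m) X j) `^ al) (X m `^ al)
  ((\sum_(j < m) Y j) `^ (1 - al)) (Y m `^ (1 - al)) al^-1 (1 - al)^-1.
rewrite !powR_ge0 !invr_gt0 al0 be0 !invrK (addrC al) subrK !powK ?X0 ?Y0//.
exact.
Qed.

Lemma powR_div s t x : 0 <= s -> 0 <= t -> (s / t) `^ x = s `^ x / t `^ x.
Proof.
move=> s0 t0; rewrite powRM ?invr_ge0//; congr (_ * _).
by rewrite -(powR_inv1 t0) -powRrM mulN1r powRN.
Qed.

(** Bernoulli's inequality, as Young's inequality with second factor [1]. *)
Lemma powR_le_tangent x th : 0 <= x -> 0 < th < 1 -> x `^ th <= 1 + th * (x - 1).
Proof.
move=> x0 /andP[th0 th1].
have := @conjugate_powR R (x `^ th) 1 th^-1 (1 - th)^-1 (powR_ge0 _ _) ler01.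
rewrite !invr_gt0 th0 subr_gt0 th1 !invrK (addrC th) subrK -powRrM.
rewrite mulfV ?gt_eqF// powRr1// powR1 mulr1 => /(_ isT isT erefl) /le_trans; apply.
by rewrite le_eqVlt; apply/orP; left; apply/eqP; ring.
Qed.

(** Discrete form of the solution of the differential inequality
    [S' >= (S / K) ^ (1 - th)]: the tangent of the concave function
    [s |-> s ^ th] turns it into a constant lower bound on the increments of
    [S ^ th]. *)
Lemma powR_increments (S : nat -> R) (K : R) th N : 0 < th < 1 -> 0 < K ->
  S 0%N = 0 ->
  (forall k, (k < N)%N -> 0 <= S k /\ 0 < S k.+1) ->
  (forall k, (k < N)%N -> (S k.+1 / K) `^ (1 - th) <= S k.+1 - S k) ->
  th * N%:R <= K `^ (1 - th) * S N `^ th.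
Proof.
move=> th01 K0 S0 Spos incr; have /andP[th0 th1] := th01.
suff main k : (k <= N)%N -> th * k%:R <= K `^ (1 - th) * S k `^ th by exact: main.
elim: k => [|k IH] kN; first by rewrite mulr0 mulr_ge0// powR_ge0.
have [s0 t0] := Spos k kN; have := incr k kN; have {IH} := IH (ltnW kN).
set s := S k in s0 *; set t := S k.+1 in t0 * => IH inc.
have tE : t `^ th * t `^ (1 - th) = t.
  by rewrite -powRD ?(gt_eqF t0) ?implybT// (addrC th) subrK powRr1// ltW.
have tan : s `^ th <= t `^ th + th * ((s - t) / t `^ (1 - th)).
  have := powR_le_tangent (divr_ge0 s0 (ltW t0)) th01.
  rewrite (powR_div _ s0 (ltW t0)) ler_pdivrMr ?powR_gt0// => /le_trans; apply.
  have -> : (t `^ (1 - th))^-1 = t `^ th / t.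
    by rewrite -{3}tE invfM mulrA mulfV ?mul1r// gt_eqF ?powR_gt0.
  by rewrite le_eqVlt; apply/orP; left; apply/eqP; field; rewrite gt_eqF.
rewrite (powR_div _ (ltW t0) (ltW K0)) in inc.
have Kt := powR_gt0 (1 - th) K0; have tt := powR_gt0 (1 - th) t0.
have step : th <= K `^ (1 - th) * (th * ((t - s) / t `^ (1 - th))).
  rewrite mulrCA -[leLHS]mulr1 ler_pM2l// mulrA ler_pdivlMr// mul1r.
  by rewrite -ler_pdivrMl// mulrC.
rewrite -natr1 mulrDr mulr1.
apply: (le_trans (lerD IH step)); rewrite -mulrDr ler_pM2l//.
by move: tan; rewrite -(opprB t s) mulNr mulrN; lra.
Qed.

End PowerInequalities.

Section Growth.
Variable R : realType.

(** Hoelder's inequality, applied to [A L r^2] and [L^(-1/2)] with the exponents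
    for which the powers of [L] and [r] combine to [(r^(P-1) / L)^(2/(3P+1))],
    bounds the partial sums [S] of the [A^al] by a power of the last [A], because
    the sum of the [L^(-1/2)] is at most [2 sqrt A]. As [A^al] is the increment of
    [S], [powR_increments] gives the growth of [S], and the same bound carries it
    over to [A]. *)
Lemma weights_growth (P C E : R) (N : nat) (A L r : nat -> R) :
  1 < P -> (0 < N)%N -> A 0%N = 0 ->
  (forall k, (k < N)%N -> [/\ 0 < A k.+1, 0 < L k, 0 < r k &
    L k <= C * r k `^ (P - 1)]) ->
  (forall k, (k < N)%N ->
    Num.sqrt (A k) + (2 * Num.sqrt (L k))^-1 <= Num.sqrt (A k.+1)) ->
  \sum_(k < N) A k.+1 * L k * r k ^+ 2 <= E ->
  (2 / (P + 1) * N%:R) `^ ((3 * P + 1) / 2) <=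
  2 `^ (P + 1) * E `^ ((P - 1) / 2) * C * A N.
Proof.
move=> P1 N0 A0 pos grow energy.
have P3 : 0 < 3 * P + 1 by lra.
pose al := (P - 1) / (3 * P + 1); pose ga := 2 / (3 * P + 1).
(* The Hoelder bound reads [S <= K * (A^al)^(1 / (1 - th))]. *)
pose th := 2 / (P + 1).
have al0 : 0 < al by rewrite divr_gt0//; lra.
have al01 : 0 < al < 1 by rewrite al0 ltr_pdivrMr//; lra.
have alE : 1 - al = ga * (P + 1) by rewrite /al /ga; field; lra.
have th01 : 0 < th < 1 by rewrite divr_gt0 ?ltr_pdivrMr//; lra.
have ga0 : 0 < ga by rewrite divr_gt0.
have [A10 L0 r0 LC] := pos 0%N N0.
have C0 : 0 < C by rewrite -(pmulr_lgt0 _ (powR_gt0 (P - 1) r0)) (lt_le_trans L0).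
pose X k := A k.+1 * L k * r k ^+ 2; pose Y k := L k `^ (- 2^-1).
have Xpos k : (k < N)%N -> 0 < X k.
  by move=> /pos[? ? ? _]; rewrite !mulr_gt0// exprn_gt0.
have Ypos k : 0 <= Y k by exact: powR_ge0.
have E0 : 0 < E.
  apply: lt_le_trans energy; case: (N) N0 Xpos => // n _ Xpos.
  rewrite big_ord_recl; apply: ltr_wpDr; last exact: (Xpos 0%N).
  by apply: sumr_ge0 => i _; apply: ltW; apply: (Xpos (lift ord0 i)).
have XE m : (m <= N)%N -> \sum_(k < m) X k <= E.
  move=> mN; apply: le_trans energy; rewrite -(subnKC mN) big_split_ord /=.
  rewrite lerDl sumr_ge0// => i _; apply: ltW; apply: (Xpos (m + i)%N).
  by rewrite -[ltnRHS](subnKC mN) ltn_add2l.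
have YA m : (m <= N)%N -> \sum_(k < m) Y k <= 2 * Num.sqrt (A m).
  elim: m => [|m IH] mN; first by rewrite big_ord0 mulr_ge0// sqrtr_ge0.
  have [_ Lm _ _] := pos m mN; have := IH (ltnW mN); have := grow m mN.
  rewrite big_ord_recr /= /Y powRN powR12_sqrt ?(ltW Lm)// invfM; lra.
have termE k : (k < N)%N -> A k.+1 `^ al <= C `^ ga * (X k `^ al * Y k `^ (1 - al)).
  move=> /[dup] kN /pos[Ak Lk rk LCk].
  have -> : X k `^ al * Y k `^ (1 - al) =
      A k.+1 `^ al * ((r k `^ (P - 1)) `^ ga / L k `^ ga).
    rewrite /X /Y -(powR_mulrn 2 (ltW rk)).
    rewrite !powRM ?mulr_ge0 ?powR_ge0 ?(ltW Ak) ?(ltW Lk)//.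
    rewrite -!mulrA; congr (_ * _).
    rewrite -!powRrM -powRN mulrCA; congr (_ `^ _ * _).
      by rewrite /al /ga; field; lra.
    rewrite -powRD ?(gt_eqF Lk) ?implybT//; congr (_ `^ _).
    by rewrite alE /al /ga; field; lra.
  rewrite mulrCA ler_peMr ?powR_ge0// mulrA ler_pdivlMr ?powR_gt0// mul1r.
  rewrite -powRM ?powR_ge0 ?(ltW C0)//.
  by apply: le_powRl; rewrite // ltW.
pose S m := \sum_(k < m) A k.+1 `^ al.
pose K := C `^ ga * E `^ al * 2 `^ (1 - al).
have K0 : 0 < K by rewrite !mulr_gt0 ?powR_gt0.
have SK m : (m <= N)%N -> S m <= K * Num.sqrt (A m) `^ (1 - al).
  move=> mN; have b0 : 0 <= 1 - al by rewrite subr_ge0 ltW; case/andP: al01.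
  apply: (@le_trans _ _ (C `^ ga * \sum_(k < m) X k `^ al * Y k `^ (1 - al))).
    rewrite mulr_sumr; apply: ler_sum => k _; apply: termE.
    exact: leq_trans (ltn_ord k) mN.
  have Xm k : (k < m)%N -> 0 <= X k.
    by move=> km; apply: ltW; apply: Xpos; exact: leq_trans km mN.
  rewrite /K -!mulrA ler_pM2l ?powR_gt0//.
  apply: (le_trans (sum_hoelder al01 Xm (fun k _ => Ypos k))).
  rewrite -powRM ?sqrtr_ge0//; apply: ler_pM; rewrite ?powR_ge0//.
    by apply: le_powRl; rewrite ?(ltW al0) ?XE// sumr_ge0// => k _; exact: Xm.
  by apply: le_powRl; rewrite ?YA// sumr_ge0.
have Apos m : (m < N)%N -> 0 < A m.+1 by case/pos.
have ASE m : (m < N)%N ->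
    (Num.sqrt (A m.+1) `^ (1 - al)) = (A m.+1 `^ al) `^ ((1 - th)^-1).
  move=> /Apos/ltW Am; rewrite -(powR12_sqrt Am) -!powRrM.
  congr (_ `^ _); rewrite alE /al /ga /th; field.
  by apply/and3P; split; lra.
have incr : th * N%:R <= K `^ (1 - th) * S N `^ th.
  apply: powR_increments => // [|k kN|k kN]; first by rewrite /S big_ord0.
    have S0 : 0 <= S k by apply: sumr_ge0 => i _; exact: powR_ge0.
    by rewrite /S big_ord_recr /= ltr_wpDl// powR_gt0// Apos.
  have -> : S k.+1 - S k = A k.+1 `^ al by rewrite /S big_ord_recr /= addrAC subrr add0r.
  have th1 : 0 < 1 - th by rewrite subr_gt0; case/andP: th01.
  have -> : A k.+1 `^ al = (Num.sqrt (A k.+1) `^ (1 - al)) `^ (1 - th).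
    by rewrite ASE// -[RHS]powRrM mulVf ?gt_eqF// powRr1// powR_ge0.
  apply: le_powRl; first exact: ltW.
    by rewrite divr_ge0 ?(ltW K0)//; apply: sumr_ge0 => i _; exact: powR_ge0.
  by rewrite ler_pdivrMr// mulrC SK.
have {}incr : th * N%:R <= K * A N `^ ga.
  have AN : 0 < A N by case: (N) N0 Apos => // n _; apply.
  have -> : K * A N `^ ga = K `^ (1 - th) * (K * Num.sqrt (A N) `^ (1 - al)) `^ th.
    rewrite powRM ?powR_ge0 ?(ltW K0)// mulrA -powRD ?(gt_eqF K0) ?implybT//.
    rewrite subrK powRr1 ?(ltW K0)//; congr (_ * _).
    rewrite -powR12_sqrt ?(ltW AN)// -!powRrM; congr (_ `^ _).
    by rewrite alE /ga /th; field; apply/andP; split; lra.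
  apply: (le_trans incr); rewrite ler_pM2l ?powR_gt0//.
  apply: le_powRl; rewrite ?SK//; first by case/andP: th01 => /ltW.
  by apply: sumr_ge0 => i _; exact: powR_ge0.
have gaV : ga^-1 = (3 * P + 1) / 2 by rewrite /ga invf_div.
rewrite -gaV.
apply: (@le_trans _ _ ((K * A N `^ ga) `^ ga^-1)).
  apply: le_powRl; rewrite ?incr ?invr_ge0 ?(ltW ga0)//.
  by rewrite mulr_ge0//; case/andP: th01 => /ltW.
have AN : 0 <= A N by case: (N) N0 Apos => // n _ /(_ n (leqnn _))/ltW.
rewrite /K !powRM ?mulr_ge0 ?powR_ge0//.
rewrite -!powRrM mulfV ?gt_eqF// !powRr1 ?(ltW C0)//.
have -> : al / ga = (P - 1) / 2 by rewrite /al /ga; field; lra.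
have -> : (1 - al) / ga = P + 1 by rewrite alE mulrAC mulfV ?mul1r ?gt_eqF.
by rewrite le_eqVlt; apply/orP; left; apply/eqP; ring.
Qed.

Lemma weights_growth_bounded (C : R) (N : nat) (A L : nat -> R) :
  A 0%N = 0 -> (forall k, (k < N)%N -> [/\ 0 < A k.+1, 0 < L k & L k <= C]) ->
  (forall k, (k < N)%N ->
    Num.sqrt (A k) + (2 * Num.sqrt (L k))^-1 <= Num.sqrt (A k.+1)) ->
  N%:R ^+ 2 <= 4 * C * A N.
Proof.
case: N => [|N] A0 pos grow; first by rewrite A0 mulr0 expr0n.
have [_ L0 LC] := pos 0%N isT; have C0 : 0 < C := lt_le_trans L0 LC.
set c := Num.sqrt C; have c0 : 0 < c by rewrite sqrtr_gt0.
have main k : (k <= N.+1)%N -> k%:R <= 2 * c * Num.sqrt (A k).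
  elim: k => [|k IH] kN; first by rewrite !mulr_ge0 ?sqrtr_ge0.
  have [_ Lk LkC] := pos k kN; have := IH (ltnW kN).
  have cL : (2 * c)^-1 <= (2 * Num.sqrt (L k))^-1.
    by rewrite lef_pV2 ?posrE ?mulr_gt0 ?sqrtr_gt0// ler_pM2l// ler_wsqrtr.
  have c20 : 0 < 2 * c by rewrite mulr_gt0.
  have := ler_wpM2l (ltW c20) (le_trans (lerD (lexx _) cL) (grow k kN)).
  rewrite mulrDr mulfV ?gt_eqF// -natr1; lra.
have [AN _ _] := pos N (ltnSn N).
rewrite -(sqr_sqrtr (ltW C0)) -/c -(sqr_sqrtr (ltW AN)).
have -> : 4 * c ^+ 2 * Num.sqrt (A N.+1) ^+ 2 = (2 * c * Num.sqrt (A N.+1)) ^+ 2 by ring.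
by rewrite ler_sqr ?nnegrE ?main// !mulr_ge0 ?sqrtr_ge0 ?(ltW c0).
Qed.

End Growth.

(** * The convergence rate *)
Section Rate.
Variable R : realType.

Lemma sqr_succ_le_exp2 p : ((p.+1) ^ 2 <= 2 ^ p.+2)%N.
Proof.
case: p => [//|[//|]]; elim=> [//|p IH].
rewrite (expnS 2 p.+4); apply: leq_trans (leq_mul (leqnn 2) IH).
by rewrite !expnS !expn0 !muln1; nia.
Qed.

(** Only [(P + 1)^2 <= 2^(P + 2)] and [4/3 <= 2^(1/2)] are lost; the exponents
    of [2] then add up exactly. *)
Lemma rate_constant p (P := p%:R : R) : (0 < p)%N ->
  2 `^ (P + 2) * (4 / 3) `^ ((P - 1) / 2) * ((P + 1) / 2) `^ ((3 * P + 1) / 2)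
  <= 2 `^ ((3 * (P + 1) ^+ 2 + 4) / 4).
Proof.
move=> p0; have P1 : 1 <= P by rewrite ler1n.
have h1 : (P + 1) / 2 <= 2 `^ (P / 2).
  rewrite -ler_sqr ?nnegrE ?powR_ge0 ?divr_ge0//; last lra.
  rewrite -[in leRHS]powR_mulrn ?powR_ge0// -powRrM.
  have -> : P / 2 * 2%:R = P by field.
  rewrite powR_mulrn// expr_div_n ler_pdivrMr ?exprn_gt0//.
  have := sqr_succ_le_exp2 p; rewrite -(ler_nat R) !natrX -natr1 -/P !exprS; lra.
have h2 : 4 / 3 <= (2 : R) `^ 2^-1.
  rewrite powR12_sqrt// -ler_sqr ?nnegrE ?sqrtr_ge0// sqr_sqrtr//; lra.
apply: (@le_trans _ _ (2 `^ (P + 2) * (2 `^ 2^-1) `^ ((P - 1) / 2) *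
    (2 `^ (P / 2)) `^ ((3 * P + 1) / 2))).
  apply: ler_pM; rewrite ?mulr_ge0 ?powR_ge0//; last first.
    by apply: le_powRl => //; lra.
  by rewrite ler_pM2l ?powR_gt0//; apply: le_powRl => //; lra.
rewrite -!powRrM -!powRD; last 2 first.
- by rewrite pnatr_eq0 implybT.
- by rewrite pnatr_eq0 implybT.
rewrite le_eqVlt; apply/orP; left; apply/eqP; congr (_ `^ _); by field.
Qed.

(** Eliminates [A] between the lower bound on its growth and the potential bound
    [A * delta <= D^2 / 2]. *)
Lemma rate_of_growth p (P := p%:R : R) (N : nat) (M D delta A : R) :
  (0 < p)%N -> 0 <= M -> 0 <= D -> 0 <= delta ->
  (2 / (P + 1) * N%:R) `^ ((3 * P + 1) / 2) <=
    2 `^ (P + 1) * (4 / 3 * D ^+ 2) `^ ((P - 1) / 2) * (4 * (P + 1) * M / p`!%:R) * A ->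
  A * delta <= D ^+ 2 / 2 ->
  delta * N%:R `^ ((3 * P + 1) / 2) <=
  2 `^ ((3 * (P + 1) ^+ 2 + 4) / 4) * (P + 1) / p`!%:R * M * D ^+ p.+1.
Proof.
move=> p0 M0 D0 delta0 grow pot; have P1 : 1 <= P by rewrite ler1n.
have fact0' : 0 < p`!%:R :> R by rewrite ltr0n fact_gt0.
set C := 4 * (P + 1) * M / p`!%:R in grow.
have DE : (4 / 3 * D ^+ 2) `^ ((P - 1) / 2) = (4 / 3) `^ ((P - 1) / 2) * D ^+ p.-1.
  rewrite powRM ?exprn_ge0//; congr (_ * _).
  rewrite -(powR_mulrn 2 D0) -powRrM -(powR_mulrn _ D0) -subn1 natrB//.
  by congr (_ `^ _); field.
set e := (3 * P + 1) / 2 in grow *; set B := (4 / 3) `^ _ in DE.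
have tQ : (2 / (P + 1)) `^ e * ((P + 1) / 2) `^ e = 1.
  rewrite -powRM ?divr_ge0//; try lra.
  by have -> : 2 / (P + 1) * ((P + 1) / 2) = 1; [field; lra | rewrite powR1].
rewrite DE powRM// in grow; last by rewrite divr_ge0//; lra.
set Q := ((P + 1) / 2) `^ e in tQ; have Q0 : 0 <= Q := powR_ge0 _ _.
have -> : N%:R `^ e = (2 / (P + 1)) `^ e * N%:R `^ e * Q.
  by rewrite mulrAC tQ mul1r.
rewrite mulrA; apply: (le_trans (ler_wpM2r Q0 (ler_wpM2l delta0 grow))).
have -> : delta * (2 `^ (P + 1) * (B * D ^+ p.-1) * C * A) * Q =
    (A * delta) * (2 `^ (P + 1) * (B * D ^+ p.-1) * C * Q) by ring.
have W0 : 0 <= 2 `^ (P + 1) * (B * D ^+ p.-1) * C * Q.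
  by rewrite !mulr_ge0 ?powR_ge0 ?exprn_ge0// ?invr_ge0 ?M0//; lra.
apply: (le_trans (ler_wpM2r W0 pot)).
have -> : D ^+ 2 / 2 * (2 `^ (P + 1) * (B * D ^+ p.-1) * C * Q) =
    (2 `^ (P + 2) * B * Q) * ((P + 1) / p`!%:R * M * D ^+ p.+1).
  have -> : D ^+ p.+1 = D ^+ p.-1 * D ^+ 2 by rewrite -exprD addn2 prednK.
  have -> : 2 `^ (P + 2) = 2 `^ (P + 1) * 2.
    rewrite (_ : P + 2 = P + 1 + 1); last by rewrite -addrA.
    by rewrite [LHS]powRD ?powRr1// pnatr_eq0 implybT.
  by rewrite /C; field; rewrite gt_eqF.
have -> : 2 `^ ((3 * (P + 1) ^+ 2 + 4) / 4) * (P + 1) / p`!%:R * M * D ^+ p.+1 = 2 `^ ((3 * (P + 1) ^+ 2 + 4) / 4) *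
    ((P + 1) / p`!%:R * M * D ^+ p.+1) by ring.
apply: ler_wpM2r (rate_constant p0).
by rewrite !mulr_ge0 ?exprn_ge0 ?invr_ge0 ?M0 ?(ltW fact0')//; lra.
Qed.

End Rate.

Theorem theorem1 (R : realType) (n p : nat) (M : R) (f : 'rV[R]_n -> R)
    (xstar : 'rV[R]_n) (N : nat) (L a A : nat -> R)
    (x y u : nat -> 'rV[R]_n) :
  (1 <= p)%N ->
  convex_function [set: 'rV[R]_n] f ->
  times_differentiable p f ->
  lipschitz_dirder p M f ->
  minimizer f xstar ->
  (1 <= N)%N ->
  u 0%N = y 0%N ->
  optimal_tensor_method p M f N L a A x y u ->
  let c : R :=
    2 `^ ((3 * (p%:R + 1) ^+ 2 + 4) / 4) * (p%:R + 1) / p`!%:R in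
  f (y N) - f xstar
  <= c * M * norm2 (y 0%N - xstar) ^+ p.+1 / N%:R `^ ((3 * p%:R + 1) / 2).
Proof.
move=> p0 cf fp lipf fmin N0 u0 otm; cbv zeta.
set c : R := (X in X * M).
have df z : differentiable f z := differentiable_dirder (s := [::]) z fp p0.
have delta0 : 0 <= f (y N) - f xstar by rewrite subr_ge0.
set P : R := p%:R in c *; have P1 : 1 <= P by rewrite ler1n.
have fact0' : 0 < p`!%:R :> R by rewrite ltr0n fact_gt0.
pose r k := norm2 (y k.+1 - x k).
have r0 k : 0 <= r k := norm2_ge0 _.
pose C := 4 * (P + 1) * M / p`!%:R.
have Lpos k (kN : (k < N)%N) : 0 < L k := otm_L_gt0 otm kN.
have LC k : (k < N)%N -> 2 * (P + 1) * M / p`!%:R * r k ^+ p.-1 <= L k <= C * r k ^+ p.-1.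
  move=> kN; have := otm_L otm kN; have Lk := Lpos k kN.
  have -> : 2 * (p%:R + 1) * M / (p`!%:R * L k) * norm2 (y k.+1 - x k) ^+ p.-1 =
      2 * (P + 1) * M / p`!%:R * r k ^+ p.-1 / L k.
    by rewrite invfM -/P -/(r k); ring.
  rewrite ler_pdivlMr// ler_pdivrMr// => /andP[? ?].
  by apply/andP; split; rewrite /C; lra.
(* Otherwise the upper bound in [LC] would not be positive. *)
have M0 : 0 < M.
  rewrite ltNge; apply/negP => M0; have /andP[_] := LC 0%N N0; rewrite leNgt.
  move/negP; apply; apply: le_lt_trans (Lpos 0%N N0).
  have -> : C * r 0%N ^+ p.-1 = 4 * (P + 1) / p`!%:R * r 0%N ^+ p.-1 * M.
    by rewrite /C; ring.
  rewrite mulr_ge0_le0// mulr_ge0 ?exprn_ge0 ?r0// divr_ge0 ?(ltW fact0')//; lra.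
rewrite ler_pdivlMr ?powR_gt0 ?ltr0n//.
have [p1|p1] := leqP p 1; last first.
  have rpos k : (k < N)%N -> r k != 0.
    move=> kN; apply/eqP => rk; have /andP[_] := LC k kN.
    rewrite rk expr0n -subn1 subn_eq0 leqNgt p1 mulr0 => Lk.
    by have := lt_le_trans (Lpos k kN) Lk; rewrite ltxx.
  have res k : (k < N)%N -> norm2 (grad f (y k.+1) + L k *: (y k.+1 - x k))
      <= 2^-1 * L k * norm2 (y k.+1 - x k).
    move=> kN; apply: le_trans
      (tensor_step_residual p1 (ltW M0) fp lipf (otm_y otm kN) (rpos k kN)) _.
    have /andP[+ _] := LC k kN; rewrite -/(r k) => /(ler_wpM2r (r0 k)).
    have -> : r k ^+ p = r k ^+ p.-1 * r k by rewrite -exprSr prednK.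
    rewrite -/P; lra.
  have pot := otm_potential xstar otm cf df res; rewrite u0 in pot.
  set D := norm2 (y 0%N - xstar) in pot *.
  have AN : 0 < A N by rewrite -(prednK N0); apply: (otm_A_gt0 otm); rewrite prednK.
  have P1' : 1 < P by rewrite ltr1n.
  have pos k : (k < N)%N -> [/\ 0 < A k.+1, 0 < L k, 0 < r k & L k <= C * r k `^ (P - 1)].
    move=> kN; have /andP[_ Lk] := LC k kN; have PE : P - 1 = p.-1%:R.
      by rewrite -subn1 natrB.
    rewrite PE powR_mulrn//; split=> //; first exact: (otm_A_gt0 otm kN).
      exact: Lpos.
    by rewrite lt0r rpos// r0.
  have s0 : 0 <= \sum_(k < N) A k.+1 * L k * r k ^+ 2.
    apply: sumr_ge0 => k _; have [? ? ? _] := pos k (ltn_ord k).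
    by rewrite !mulr_ge0 ?exprn_ge0 ?ltW.
  (* [4/3] is the inverse of [1 - s^2] for the relative residual [s = 1/2]. *)
  have pot1 : \sum_(k < N) A k.+1 * L k * r k ^+ 2 <= 4 / 3 * D ^+ 2.
    by have := mulr_ge0 (ltW AN) delta0; move: pot; rewrite -/(r _); lra.
  have pot2 : A N * (f (y N) - f xstar) <= D ^+ 2 / 2 by move: pot; lra.
  have grow := weights_growth P1' N0 (otm_A0 otm) pos (fun k kN => otm_sqrt_A otm kN) pot1.
  exact: (rate_of_growth p0 (ltW M0) (norm2_ge0 _) delta0 grow pot2).
have {p1} pE : p = 1%N by apply/eqP; rewrite eqn_leq p1.
have PE : P = 1 by rewrite /P pE.
have CE : C = 8 * M by rewrite /C PE pE (factS 0) fact0 divr1; ring.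
(* With relative residual [1] the potential bounds no step lengths, but for
   [p = 1] the [L k] are bounded anyway. *)
have res k : (k < N)%N -> norm2 (grad f (y k.+1) + L k *: (y k.+1 - x k))
    <= 1 * L k * norm2 (y k.+1 - x k).
  move=> kN; rewrite mul1r.
  have /andP[ML _] := LC k kN.
  have step := otm_y otm kN; move: fp lipf step ML.
  rewrite PE pE (factS 0) fact0 expr0 mulr1 divr1 => fp1 lip1 step1 ML.
  by apply: (gradient_step_residual (ltW M0) _ fp1 lip1 step1); move: M0 ML; lra.
have pot := otm_potential xstar otm cf df res; rewrite u0 in pot.
have pot2 : A N * (f (y N) - f xstar) <= norm2 (y 0%N - xstar) ^+ 2 / 2.
  by move: pot; rewrite expr1n subrr !mul0r addr0.
have LC1 k : (k < N)%N -> [/\ 0 < A k.+1, 0 < L k & L k <= C].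
  move=> kN; have /andP[_] := LC k kN; rewrite pE expr0 mulr1.
  by split=> //; [exact: (otm_A_gt0 otm kN) | exact: Lpos].
have grow := weights_growth_bounded (otm_A0 otm) LC1 (fun k kN => otm_sqrt_A otm kN).
apply: (rate_of_growth p0 (ltW M0) (norm2_ge0 _) delta0 _ pot2).
rewrite -/P -/C PE subrr mul0r powRr0 !mulr1.
have -> : (3 + 1) / 2 = 2%:R :> R by field.
have -> : 2 / (1 + 1) * N%:R = N%:R :> R by field.
rewrite powR_mulrn//; apply: (le_trans grow).
by rewrite (_ : 1 + 1 = 2%:R)// powR_mulrn// -natrX.
Qed.
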